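(* Let $g$ be the logarithmic mean and let $u_0:\mathcal P(G)\to\mathbb R$ be Fréchet continuously differentiable. Let $T>0$. (i) For every $\mu\in\mathcal P(G)$ the initial value problem $$\dot\sigma^\mu=\operatorname{div}_{\sigma^\mu}(\nabla_G\log\sigma^\mu)=A\sigma^\mu,\qquad \sigma^\mu(0)=\mu,$$ admits a unique solution $\sigma^\mu:[0,T]\to\mathcal P(G)$. (ii) The function $u(t,\mu)=u_0(\sigma^\mu(t))$, $t\in[0,T]$, $\mu\in\mathcal P(G)$, satisfies $$\partial_t u(t,\mu)=\Delta_{\mathrm{ind}}u(t,\mu),\qquad u(0,\mu)=u_0(\mu).$$
   Context: $G=(V,E,\omega)$ is a finite, simple, connected, undirected graph with $V=\{1,\dots,n\}$, $E\subset V^2$ (sums over $(i,j)\in E$ run over ordered pairs), and $\omega=(\omega_{ij})$ a symmetric $n\times n$ matrix with $\omega_{ij}>0$ if $(i,j)\in E$ and $\omega_{ij}=0$ otherwise; $N(i)$ is the set of vertices connected to $i$ by an edge. $\mathcal P(G)=\{\rho\in\mathbb R^n:\sum_i\rho_i=1,\ \rho_i\ge0\}$. $\mathbb S^{n\times n}$ is the set of skew-symmetric real $n\times n$ matrices, and $(\cdot,\cdot)$ is the Euclidean inner product on $\mathbb R^n$. The logarithmic mean is $g(s,t)=\frac{s-t}{\log s-\log t}$ if $s\ne t$, $st\ne0$; $g(s,t)=0$ if $st=0$; $g(s,t)=t$ if $s=t$, $st\neq 0$. Write $g_{ij}(\rho)=g(\rho_i,\rho_j)$. The matrix $A\in\mathbb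 R^{n\times n}$ is: $A_{ij}=\omega_{ij}$ if $j\in N(i)$; $A_{ij}=0$ if $j\notin N(i)$ and $j\ne i$; $A_{ii}=-\sum_{k\in N(i)}\omega_{ik}$. For $\phi\in\mathbb R^n$, $(\nabla_G\phi)_{ij}=\sqrt{\omega_{ij}}(\phi_i-\phi_j)$. For $v,\bar v\in\mathbb S^{n\times n}$: $(\operatorname{div}_\rho(v))_i=\sum_{j\in N(i)}\sqrt{\omega_{ij}}\,g_{ij}(\rho)v_{ji}$ and $(v,\bar v)_\rho=\frac12\sum_{(i,j)\in E}g_{ij}(\rho)v_{ij}\bar v_{ij}$. $\log\mu$ is taken componentwise. When all $\mu_i>0$ one has $\operatorname{div}_\mu(\nabla_G\log\mu)=A\mu$; for $\mu$ with some zero component, $\operatorname{div}_\mu(\nabla_G\log\mu)$ denotes the continuous extension $A\mu$. A function $\mathcal F:\mathcal P(G)\to\mathbb R$ has Fréchet derivative $f=\frac{\delta\mathcal F}{\delta\rho}(\rho)\in\mathbb R^n$ at $\rho$ if $\sum_if_i=0$ and for every $\bar\rho\in\mathcal P(G)$, $\lim_{t\to0}\frac{\mathcal F((1-t)\rho+t\bar\rho)-\mathcal F(\rho)}{t}=(f,\bar\rho-\rho)$ (the limit being over $t$ with $(1-t)\rho+t\bar\rho\in\mathcal P(G)$). $\mathcal F$ is Fréchet continuously differentiable if it has a Fréchet derivative at every $\rho\in\mathcal P(G)$ and $\rho\mapsto\frac{\delta\mathcal F}{\delta\rho}(\rho)$ is continuous. In that case its Wasserstein gradient is $\nabla_{\mathcal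 W}\mathcal F(\rho)=\nabla_G\big(\frac{\delta\mathcal F}{\delta\rho}(\rho)\big)$. The individual noise operator is $\Delta_{\mathrm{ind}}u(t,\mu)=\big(\operatorname{div}_\mu(\nabla_{\mathcal W}u(t,\mu)),\log\mu\big)=-(\nabla_{\mathcal W}u(t,\mu),\nabla_G\log\mu)_\mu$, with the gradient taken in $\mu$. Equivalently it equals $\big(\frac{\delta u}{\delta\mu}(t,\mu),A\mu\big)$, and this last expression is its meaning when some $\mu_i=0$. *)

(* Defs.v *)
From HB Require Import structures.
From mathcomp Require Import all_boot all_order all_algebra.
From mathcomp Require Import all_classical all_reals all_analysis.

Set Implicit Arguments.
Unset Strict Implicit.
Unset Printing Implicit Defensive.

Import Order.TTheory GRing.Theory Num.Theory.
Import numFieldNormedType.Exports.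

Local Open Scope classical_set_scope.
Local Open Scope ring_scope.

Record weighted_graph (R : realType) (n : nat) := WeightedGraph {
  edge : rel 'I_n;
  weight : 'M[R]_n;
  edge_sym : symmetric edge;
  edge_irrefl : irreflexive edge;
  edge_connected : forall i j, connect edge i j;
  weight_sym : forall i j, weight i j = weight j i;
  weight_gt0 : forall i j, edge i j -> 0 < weight i j;
  weight_eq0 : forall i j, ~~ edge i j -> weight i j = 0
}.

Section Euclidean.
Context {R : realType} {n : nat}.

Definition prob : set 'cV[R]_n :=
  [set rho | \sum_i rho i 0 = 1 /\ forall i, 0 <= rho i 0].

Definition dotv (x y : 'cV[R]_n) : R := \sum_i x i 0 * y i 0.

Definition logmean (s t : R) : R :=
  if s * t == 0 then 0
  else if s == t then t
  else (s - t) / (ln s - ln t).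

Definition positive (mu : 'cV[R]_n) : bool := [forall i, 0 < mu i 0].

Definition logv (mu : 'cV[R]_n) : 'cV[R]_n := map_mx (@ln R) mu.

(* Functionals on the simplex are total functions on 'cV[R]_n; only their
   values on prob are ever used, since t ranges over those parameters for
   which the segment point stays in prob (negative t included). *)
Definition is_frechet (F : 'cV[R]_n -> R) (rho f : 'cV[R]_n) : Prop :=
  \sum_i f i 0 = 0 /\
  forall rho', prob rho' ->
    (fun t : R => (F ((1 - t) *: rho + t *: rho') - F rho) / t)
      @ within [set t : R | prob ((1 - t) *: rho + t *: rho')] (0 : R)^'
      --> dotv f (rho' - rho).

(* The vector f in is_frechet is unique for rho in prob; the default value 0
   is taken when there is none. *)
Definition frechet (F : 'cV[R]_n -> R) (rho : 'cV[R]_n) : 'cV[R]_n :=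
  xget 0 (is_frechet F rho).

Definition frechet_C1 (F : 'cV[R]_n -> R) : Prop :=
  (forall rho, prob rho -> is_frechet F rho (frechet F rho)) /\
  {within prob, continuous (frechet F)}.

End Euclidean.

(* Derivative at t of a function on [0, T], one-sided at the endpoints. *)
Definition is_deriv_on (R : realType) (V : normedModType R) (T : R)
    (f : R -> V) (t : R) (l : V) : Prop :=
  (fun h : R => h^-1 *: (f (t + h) - f t))
    @ within [set h : R | 0 <= t + h <= T] (0 : R)^' --> l.

Section Graph.
Context {R : realType} {n : nat} (G : weighted_graph R n).

Definition gradG (phi : 'cV[R]_n) : 'M[R]_n :=
  \matrix_(i, j) (Num.sqrt (weight G i j) * (phi i 0 - phi j 0)).

Definition divG (rho : 'cV[R]_n) (v : 'M[R]_n) : 'cV[R]_n :=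
  \col_i \sum_(j | edge G i j)
    Num.sqrt (weight G i j) * logmean (rho i 0) (rho j 0) * v j i.

Definition Amx : 'M[R]_n :=
  \matrix_(i, j)
    if j == i then - \sum_(k | edge G i k) weight G i k
    else if edge G i j then weight G i j else 0.

(* div_mu (grad_G log mu), extended by A mu where some component vanishes. *)
Definition div_grad_log (mu : 'cV[R]_n) : 'cV[R]_n :=
  if positive mu then divG mu (gradG (logv mu)) else Amx *m mu.

Definition gradW (F : 'cV[R]_n -> R) (rho : 'cV[R]_n) : 'M[R]_n :=
  gradG (frechet F rho).

(* (div_mu (grad_W u), log mu), extended by (du/dmu, A mu) where some
   component of mu vanishes. *)
Definition Delta_ind (u : R -> 'cV[R]_n -> R) (t : R) (mu : 'cV[R]_n) : R :=
  if positive mu then dotv (divG mu (gradW (u t) mu)) (logv mu)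
  else dotv (frechet (u t) mu) (Amx *m mu).

Definition ivp_solution (T : R) (mu : 'cV[R]_n) (sigma : R -> 'cV[R]_n) :
    Prop :=
  [/\ forall t : R, 0 <= t <= T -> prob (sigma t),
      forall t : R, 0 <= t <= T -> is_deriv_on T sigma t (div_grad_log (sigma t))
    & sigma 0 = mu].

End Graph.

(* Main.v *)
Require Import Defs.
From HB Require Import structures.
From mathcomp Require Import all_boot all_order all_algebra.
From mathcomp Require Import all_classical all_reals all_analysis.
From mathcomp Require Import complex.
From mathcomp Require Import ring lra.

(** On the open simplex the logarithmic mean is made so that
    g(s, t) (log s - log t) = s - t; hence the nonlinear equation of the flow is
    the linear heat equation sigma' = A sigma on the graph ([div_grad_logE]),
    and the whole theorem is about the semigroup S t = exp (t A).

    The matrix A is symmetric, so S t is a finite sum of terms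
    exp (t d_k) C_k with C_k the spectral projections of A; derivatives in t,
    the commutation of S t with A, and conservation of mass (constants are in
    the kernel of A) are read off from that formula ([symmetric_flow]).  The
    remaining property, positivity, comes from a minimum principle for
    differentiable curves with x' = A x ([heat_min_principle]): where an entry
    of x is smallest over both vertices and times, A x is nonnegative at this
    entry.  Since it holds for every solution and not only for those given by S,
    applying it to the two differences of a pair of solutions also gives
    uniqueness ([ivp_solution_unique]).

    For the second part, write F for u_0 and f for its derivative.  The
    definition of f only gives derivatives along segments of the simplex.  The
    mean value theorem on a segment and the continuity of f upgrade them to a
    chain rule along any differentiable curve of the simplex
    ([frechet_chain_rule]), so that
    d/dt F (S t mu) = (f (S t mu), A S t mu) = ((S t)^T f (S t mu), A mu).
    Because S t maps segments of the simplex affinely to segments of the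
    simplex, (S t)^T f (S t mu), once its mean is removed, is the derivative of
    F o S t at mu ([frechet_precomp]); the mean is invisible in the pairing with
    A mu, whose entries sum to zero.  The right-hand side is therefore the
    pairing of the derivative of u (t, .) with A mu, which is the individual
    noise operator ([Delta_indE], by the symmetry of
    phi |-> div_mu (grad phi)). *)

Set Implicit Arguments.
Unset Strict Implicit.
Unset Printing Implicit Defensive.

Import Order.TTheory GRing.Theory Num.Theory.
Import numFieldNormedType.Exports.

Local Open Scope classical_set_scope.
Local Open Scope ring_scope.

(** * Convergence of matrices and derivatives on an interval *)

Lemma mx_entry_le_norm (R : realType) m n (x : 'M[R]_(m, n)) i j : `|x i j| <= `|x|.
Proof.
by rewrite [leRHS]/Num.norm /= mx_normrE; apply/bigmax_geP; right; exists (i, j).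
Qed.

Lemma cvg_mx_entries (R : realType) (I : Type) (F : set_system I) {FF : Filter F}
    m n (f : I -> 'M[R]_(m, n)) (l : 'M[R]_(m, n)) :
  (forall i j, (fun x => f x i j) @ F --> l i j) -> f @ F --> l.
Proof.
move=> fl; apply/cvgrPdist_lt => e e0.
have : \forall x \near F, forall ij, `|l ij.1 ij.2 - f x ij.1 ij.2| < e.
  apply: filter_forall => ij.
  by have /cvgrPdist_lt/(_ _ e0) := fl ij.1 ij.2.
apply: filterS => x fx.
rewrite [ltLHS]/Num.norm /= mx_normrE; apply/bigmax_ltP; split => // ij _.
by rewrite !mxE.
Qed.

Lemma cvg_mx_entry (R : realType) (I : Type) (F : set_system I) {FF : Filter F}
    m n (f : I -> 'M[R]_(m, n)) (l : 'M[R]_(m, n)) i j :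
  f @ F --> l -> (fun x => f x i j) @ F --> l i j.
Proof.
move=> fl.
exact: (cvg_comp f (fun M : 'M[R]_(m, n) => M i j) fl
  (@coord_continuous R m n i j l)).
Qed.

Lemma cvg_mulmx (R : realType) (I : Type) (F : set_system I) {FF : Filter F}
    m n p (M : 'M[R]_(m, n)) (f : I -> 'M[R]_(n, p)) (l : 'M[R]_(n, p)) :
  f @ F --> l -> (fun x => M *m f x) @ F --> M *m l.
Proof.
move=> fl; apply: cvg_mx_entries => i j; rewrite mxE.
under eq_fun do rewrite mxE.
apply: cvg_big => [|k _]; [exact: add_continuous|apply: cvgM]; first exact: cvg_cst.
exact: cvg_mx_entry.
Qed.

Lemma cvg_dotv (R : realType) n (I : Type) (F : set_system I) {FF : Filter F}
    (f g : I -> 'cV[R]_n) (a b : 'cV[R]_n) :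
  f @ F --> a -> g @ F --> b -> (fun x => dotv (f x) (g x)) @ F --> dotv a b.
Proof.
move=> fa gb; apply: cvg_big => [|k _]; first exact: add_continuous.
by apply: cvgM; exact: cvg_mx_entry.
Qed.

(** Epsilon-delta form, with the one-sidedness at the endpoints made explicit. *)
Lemma is_deriv_onP (R : realType) (V : normedModType R) (T : R) (f : R -> V)
    (t : R) (l : V) :
  is_deriv_on T f t l <->
  forall e, 0 < e -> exists2 d, 0 < d & forall h, h != 0 -> `|h| < d ->
    0 <= t + h <= T -> `|h^-1 *: (f (t + h) - f t) - l| < e.
Proof.
rewrite /is_deriv_on; split.
  move=> /cvgrPdist_lt cf e /cf /nbhs_ballP[d /= d0 fd].
  exists d => // h h0 hd hT; rewrite distrC; apply: fd => //=.
  by rewrite /ball /= sub0r normrN.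
move=> cf; apply/cvgrPdist_lt => e /cf[d d0 fd].
apply/nbhs_ballP; exists d => //= h; rewrite /ball /= sub0r normrN => hd h0 hT.
by rewrite distrC; apply: fd.
Qed.

Lemma is_deriv_on_continuous (R : realType) (V : normedModType R) (T : R)
    (f : R -> V) (t : R) (l : V) :
  is_deriv_on T f t l -> f @ within `[0, T] (nbhs t) --> f t.
Proof.
move=> /is_deriv_onP/(_ 1 ltr01)[d d0 fd]; apply/cvgrPdist_lt => e e0.
have K0 : 0 < `|l| + 1 by rewrite ltr_wpDl.
apply/nbhs_ballP; exists (Num.min d (e / (`|l| + 1))) => /=.
  by rewrite lt_min d0 divr_gt0.
move=> s; rewrite /ball /= lt_min => /andP[sd se].
rewrite /= in_itv /= => sT; have [->|st] := eqVneq s t; first by rewrite subrr normr0.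
have h0 : s - t != 0 by rewrite subr_eq0.
have E : t + (s - t) = s by rewrite addrC subrK.
have := fd _ h0; rewrite distrC E => /(_ sd sT) => H.
have {}H : `|(s - t)^-1 *: (f s - f t)| < `|l| + 1.
  rewrite -(subrK l (_ *: _)) (le_lt_trans (ler_normD _ _)) //.
  by rewrite addrC ltrD2l.
move: H; rewrite normrZ normfV mulrC ltr_pdivrMr ?normr_gt0 //.
rewrite [`|f t - _|]distrC => /lt_le_trans; apply.
by rewrite mulrC -ler_pdivlMr // distrC ltW.
Qed.

Lemma is_deriv_on_derive (R : realType) (T : R) (f : R -> R^o) (t l : R) :
  0 < t < T -> is_deriv_on T f t l -> is_derive t 1 f l.
Proof.
move=> /andP[t0 tT] /is_deriv_onP fl.
have cf : (fun h : R => h^-1 *: ((f \o shift t) (h *: (1 : R)) - f t)) @ 0^' --> l.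
  apply/cvgrPdist_lt => e /fl[d d0 fd].
  apply/nbhs_ballP; exists (Num.min d (Num.min t (T - t))) => /=.
    by rewrite !lt_min d0 t0 subr_gt0.
  move=> h; rewrite /ball /= sub0r normrN !lt_min => /and3P[hd ht hT] h0.
  rewrite distrC [_%:A]mulr1 [h + t]addrC; apply: fd => //.
  by move: ht hT; rewrite !ltr_norml => /andP[? ?] /andP[? ?]; lra.
apply: DeriveDef; first by apply/cvg_ex; exists l.
exact: cvg_lim.
Qed.

(** * The graph Laplacian and the logarithmic mean *)

Lemma AmxE (R : realType) n (G : weighted_graph R n) (x : 'cV[R]_n) i :
  (Amx G *m x) i 0 = \sum_(j | edge G i j) weight G i j * (x j 0 - x i 0).
Proof.
have offdiag : \sum_(j | j != i) Amx G i j * x j 0 =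
    \sum_(j | edge G i j) weight G i j * x j 0.
  rewrite [LHS]big_mkcond [RHS]big_mkcond; apply: eq_bigr => j _.
  by rewrite mxE; have [->|] := eqVneq j i; rewrite ?edge_irrefl //=;
    case: ifP; rewrite ?mul0r.
rewrite mxE (bigD1 i) //= offdiag mxE eqxx mulNr mulr_suml addrC -sumrN.
rewrite -big_split /=; apply: eq_bigr => j _.
by rewrite -mulrN -mulrDr.
Qed.

Lemma Amx_sym (R : realType) n (G : weighted_graph R n) : (Amx G)^T = Amx G.
Proof.
apply/matrixP => i j; rewrite !mxE; have [->|ji] := eqVneq j i => //.
by rewrite edge_sym weight_sym.
Qed.

Lemma Amx_mass (R : realType) n (G : weighted_graph R n) :
  const_mx 1 *m Amx G = 0 :> 'rV_n.
Proof.
apply: (can_inj (@trmxK _ _ _)); rewrite trmx_mul Amx_sym trmx_const trmx0.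
apply/matrixP => i j; rewrite ord1 AmxE [RHS]mxE big1 // => k _.
by rewrite !mxE subrr mulr0.
Qed.

Lemma logmeanM (R : realType) (s t : R) : 0 < s -> 0 < t ->
  logmean s t * (ln s - ln t) = s - t.
Proof.
move=> s0 t0; rewrite /logmean mulf_eq0 (gt_eqF s0) (gt_eqF t0) /=.
have [->|st] := eqVneq s t; first by rewrite !subrr mulr0.
rewrite divfK // subr_eq0; apply: contra st => /eqP lnst.
by apply/eqP/ln_inj.
Qed.

Lemma logmeanC (R : realType) (s t : R) : logmean s t = logmean t s.
Proof.
rewrite /logmean mulrC; case: ifP => // _; have [->|st] := eqVneq s t => //.
by rewrite -[s - t]opprB -[ln s - _]opprB invrN mulrNN.
Qed.

Lemma div_gradE (R : realType) n (G : weighted_graph R n) (mu phi : 'cV[R]_n) i :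
  divG G mu (gradG G phi) i 0 =
  \sum_(j | edge G i j)
    weight G i j * logmean (mu i 0) (mu j 0) * (phi j 0 - phi i 0).
Proof.
rewrite mxE; apply: eq_bigr => j eij; rewrite mxE (weight_sym G j i).
have := sqr_sqrtr (ltW (weight_gt0 eij)).
by set r := Num.sqrt _ => <-; ring.
Qed.

(** The logarithmic mean cancels the difference of logarithms, which turns the
    nonlinear flow into the linear heat equation. *)
Lemma div_grad_logE (R : realType) n (G : weighted_graph R n) (mu : 'cV[R]_n) :
  div_grad_log G mu = Amx G *m mu.
Proof.
rewrite /div_grad_log; case: ifP => // /forallP mu0.
apply/colP => i; rewrite AmxE div_gradE; apply: eq_bigr => j _.
rewrite !mxE -mulrA -[_ - _]opprB mulrN logmeanM // opprB //.
Qed.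

(** Both sides are the Dirichlet form of phi and psi up to sign: the summand of
    their difference is antisymmetric in the two endpoints of an edge. *)
Lemma dotv_div_grad_sym (R : realType) n (G : weighted_graph R n)
    (mu phi psi : 'cV[R]_n) :
  dotv (divG G mu (gradG G phi)) psi = dotv phi (divG G mu (gradG G psi)).
Proof.
pose K i j := weight G i j * logmean (mu i 0) (mu j 0).
have KC i j : K i j = K j i by rewrite /K weight_sym logmeanC.
rewrite /dotv.
under eq_bigr do rewrite div_gradE mulr_suml.
under [RHS]eq_bigr do rewrite div_gradE mulr_sumr.
apply/eqP; rewrite -subr_eq0 -sumrB.
pose Z i j := if edge G i j then K i j * (phi j 0 * psi i 0 - phi i 0 * psi j 0) else 0.
have -> : \sum_i (\sum_(j | edge G i j)
      weight G i j * logmean (mu i 0) (mu j 0) * (phi j 0 - phi i 0) * psi i 0 -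
    \sum_(j | edge G i j)
      phi i 0 * (weight G i j * logmean (mu i 0) (mu j 0) * (psi j 0 - psi i 0))) =
    \sum_i \sum_j Z i j.
  apply: eq_bigr => i _; rewrite -sumrB big_mkcond; apply: eq_bigr => j _.
  by rewrite /Z /K; case: ifP => // _; ring.
have ZN i j : Z i j = - Z j i.
  by rewrite /Z edge_sym KC; case: ifP => _; rewrite ?oppr0 //; ring.
set S := \sum_i _; have : S = - S.
  rewrite {1}/S exchange_big -sumrN; apply: eq_bigr => i _.
  by rewrite -sumrN; apply: eq_bigr => j _.
by move/eqP; rewrite -subr_eq0 opprK -mulr2n mulrn_eq0.
Qed.

Lemma Delta_indE (R : realType) n (G : weighted_graph R n) u t (mu : 'cV[R]_n) :
  Delta_ind G u t mu = dotv (frechet (u t) mu) (Amx G *m mu).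
Proof.
rewrite /Delta_ind; case: ifP => // mu0.
by rewrite /gradW dotv_div_grad_sym -div_grad_logE /div_grad_log mu0.
Qed.

(** * The flow of a symmetric matrix *)

(** Spectral decomposition of a real symmetric matrix, with possibly repeated
    eigenvalues.  The unitary diagonalization P^-1 D P over the complex numbers
    has D real, and the rank-one pieces P^-1 E_kk P then satisfy linear
    equations with real coefficients, which their real parts inherit. *)
Lemma symmetric_projections (R : rcfType) n (A : 'M[R]_n) : A^T = A ->
  exists (d : 'I_n -> R) (C : 'I_n -> 'M[R]_n),
    [/\ \sum_k C k = 1%:M, forall k, A *m C k = d k *: C k
      & forall k, C k *m A = d k *: C k].
Proof.
move=> Asym.
have Re0 : complex.Re (0 : R[i]) = 0 by [].
have ReD : {morph @complex.Re R : x y / x + y} by move=> [a b] [c d].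
have ReZ (a : R) (z : R[i]) : complex.Re (a%:C%C * z) = a * complex.Re z.
  by case: z => x y /=; rewrite mul0r subr0.
have Re_sum (I : finType) (F : I -> R[i]) : complex.Re (\sum_k F k) = \sum_k complex.Re (F k).
  exact: (big_morph (@complex.Re R) ReD Re0).
pose B : 'M[R[i]]_n := map_mx (real_complex R) A.
have Bherm : B \is hermsymmx.
  apply: realsym_hermsym.
    by apply/is_hermitianmxP; rewrite expr0 scale1r map_mx_id // map_trmx Asym.
  by apply/mxOverP => i j; rewrite mxE complex_real.
have /orthomx_spectralP BE := hermitian_normalmx Bherm.
have /mxOverP dr := hermitian_spectral_diag_real Bherm.
set P := spectralmx B in BE; set sp := spectral_diag B in BE dr.
have Pu : P \in unitmx by exact: spectral_unit.
(* The spectral projections over the complex numbers. *)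
pose Q k := invmx P *m delta_mx k k *m P.
have BQ k : B *m Q k = sp 0 k *: Q k.
  rewrite BE /Q !mulmxA mulmxK // -(mulmxA _ (diag_mx sp)) mul_diag_mx.
  rewrite scalemxAl scalemxAr; congr (_ *m _ *m P).
  apply/matrixP => i j; rewrite !mxE.
  by have [->|] := eqVneq i k; rewrite ?mulr0.
have QB k : Q k *m B = sp 0 k *: Q k.
  rewrite BE /Q !mulmxA mulmxK // -(mulmxA _ (delta_mx k k)) mul_mx_diag.
  rewrite scalemxAl scalemxAr; congr (_ *m _ *m P).
  apply/matrixP => i j; rewrite !mxE.
  by have [->|] := eqVneq j k; rewrite ?andbF ?mul0r ?mulr0 // mulrC.
have Q1 : \sum_k Q k = 1%:M.
  by rewrite -mulmx_suml -mulmx_sumr -mx1_sum_delta mulmx1 mulVmx.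
exists (fun k => complex.Re (sp 0 k)), (fun k => map_mx (@complex.Re R) (Q k)).
have spE k : sp 0 k = (complex.Re (sp 0 k))%:C%C by rewrite RRe_real.
split => [|k|k].
- apply/matrixP => i j; rewrite summxE.
  under eq_bigr do rewrite mxE.
  by rewrite -Re_sum -summxE Q1 !mxE; case: (i == j).
- apply/matrixP => i j.
  have /matrixP/(_ i j)/(congr1 (@complex.Re R)) := BQ k.
  rewrite spE !mxE Re_sum ReZ => <-.
  by apply: eq_bigr => l _; rewrite !mxE ReZ.
- apply/matrixP => i j.
  have /matrixP/(_ i j)/(congr1 (@complex.Re R)) := QB k.
  rewrite spE !mxE Re_sum ReZ => <-.
  by apply: eq_bigr => l _; rewrite !mxE [in RHS]mulrC ReZ mulrC.
Qed.

(** The flow is exp (t A), written as the sum of the exp (t d_k) C_k.  A left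
    null vector r of A satisfies d_k (r C_k) = r A C_k = 0, so that only the
    terms with d_k = 0, which do not move, contribute to r S t. *)
Lemma symmetric_flow (R : realType) n (A : 'M[R]_n) : A^T = A ->
  exists S : R -> 'M[R]_n,
    [/\ S 0 = 1%:M, forall t, A *m S t = S t *m A,
        forall (r : 'rV[R]_n) t, r *m A = 0 -> r *m S t = r
      & forall T t (v : 'cV[R]_n),
          is_deriv_on T (fun s => S s *m v) t (A *m (S t *m v))].
Proof.
move=> /symmetric_projections[d [C [C1 AC CA]]].
exists (fun t => \sum_k expR (t * d k) *: C k); split.
- by under eq_bigr do rewrite mul0r expR0 scale1r.
- move=> t; rewrite mulmx_sumr mulmx_suml; apply: eq_bigr => k _.
  by rewrite -scalemxAr -scalemxAl AC CA.
- move=> r t rA; rewrite -[RHS]mulmx1 -C1 !mulmx_sumr; apply: eq_bigr => k _.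
  have : d k *: (r *m C k) = 0 by rewrite scalemxAr -AC mulmxA rA mul0mx.
  move=> /eqP; rewrite scaler_eq0 => /orP[/eqP->|/eqP rC].
    by rewrite mulr0 expR0 scale1r.
  by rewrite -scalemxAr rC scaler0.
- move=> T t v; rewrite /is_deriv_on.
  have -> : A *m ((\sum_k expR (t * d k) *: C k) *m v) =
      \sum_k (d k * expR (t * d k)) *: (C k *m v).
    rewrite mulmx_suml mulmx_sumr; apply: eq_bigr => k _.
    by rewrite -!scalemxAl -scalemxAr mulmxA AC -scalemxAl scalerA mulrC.
  have -> : (fun h => h^-1 *: ((\sum_k expR ((t + h) * d k) *: C k) *m v -
      (\sum_k expR (t * d k) *: C k) *m v)) =
      (fun h => \sum_k (h^-1 * (expR ((t + h) * d k) - expR (t * d k))) *: (C k *m v)).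
    apply: funext => h; rewrite !mulmx_suml -sumrB scaler_sumr; apply: eq_bigr => k _.
    by rewrite -!scalemxAl -scalerBl scalerA.
  apply: cvg_big => [|k _]; first exact: add_continuous.
  apply: cvgZr_tmp; apply: cvg_within_filter.
  have dE : is_derive t 1 (fun s => expR (s * d k)) (d k * expR (t * d k)).
    by apply: is_derive_eq; rewrite scaler0 add0r [_%:A]mulr1 mulrC.
  have dlim := @ex_derive _ _ _ _ _ _ _ dE.
  have {dlim} := dlim : _ --> derive _ t 1.
  rewrite derive_val; apply: cvg_trans; apply: near_eq_cvg; near=> h => /=.
  by rewrite [h%:A]mulr1 [h + t]addrC.
  Unshelve. all: by end_near.
Qed.

(** * The simplex *)

Lemma sum_entriesE (R : realType) n (v : 'cV[R]_n) :
  \sum_i v i 0 = ((const_mx 1 : 'rV_n) *m v) 0 0.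
Proof. by rewrite mxE; apply: eq_bigr => i _; rewrite mxE mul1r. Qed.

Lemma prob_pos (R : realType) n (rho : 'cV[R]_n) : prob rho -> (0 < n)%N.
Proof.
case: n rho => // rho [+ _]; rewrite big_ord0 => /eqP.
by rewrite eq_sym oner_eq0.
Qed.

Lemma prob_conv (R : realType) n (x y : 'cV[R]_n) t :
  prob x -> prob y -> 0 <= t <= 1 -> prob ((1 - t) *: x + t *: y).
Proof.
move=> [sx x0] [sy y0] /andP[t0 t1]; split.
  under eq_bigr do rewrite !mxE.
  by rewrite big_split -!mulr_sumr sx sy /= !mulr1 subrK.
by move=> i; rewrite !mxE addr_ge0 // mulr_ge0 // subr_ge0.
Qed.

Lemma prob_segment (R : realType) n (x y : 'cV[R]_n) t :
  prob x -> prob y -> 0 <= t <= 1 -> prob (x + t *: (y - x)).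
Proof.
move=> px py /(prob_conv px py).
by rewrite scalerBl scale1r scalerBr -addrA [- _ + _]addrC.
Qed.

Lemma prob_delta (R : realType) n (i : 'I_n) : prob (delta_mx i 0 : 'cV[R]_n).
Proof.
split; last by move=> j; rewrite mxE ler0n.
rewrite (bigD1 i) //= mxE !eqxx big1 ?addr0 // => j /negbTE ji.
by rewrite mxE ji.
Qed.

(** * The heat flow on the simplex *)

(** At a global minimum over vertices and times, the graph Laplacian is
    nonnegative; a positive tilt e s makes the time derivative there positive,
    so that the minimum can only be attained at time 0. *)
Lemma heat_min_principle (R : realType) n (G : weighted_graph R n) (T : R)
    (x : R -> 'cV[R]_n) :
  (forall t, 0 <= t <= T -> is_deriv_on T x t (Amx G *m x t)) ->
  (forall i, 0 <= x 0 i 0) ->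
  forall t, 0 <= t <= T -> forall i, 0 <= x t i 0.
Proof.
move=> dx x0 t tT i.
have T0 : 0 <= T by case/andP: tT; exact: le_trans.
(* The tilt e * t is absorbed by applying the tilted bound with e / (1 + t). *)
suff tilted e : 0 < e -> 0 <= x t i 0 + e * t.
  have /andP[t0 _] := tT; have t1 : 0 < 1 + t by rewrite ltr_pwDl.
  apply/ler_addgt0Pr => e e0.
  have := tilted _ (divr_gt0 e0 t1); rewrite addrC => /le_trans; apply.
  rewrite [leRHS]addrC lerD2r mulrAC ler_pdivrMr // ler_wpM2l ?ltW //.
  by rewrite ltrDr.
move=> e0.
pose y j s := x s j 0 + e * s.
have /boolp.choice[c cP] : forall j, exists c,
    0 <= c <= T /\ forall s, 0 <= s <= T -> y j c <= y j s.
  move=> j.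
  have [|c cT cmin] := @EVT_min R (y j) 0 T T0.
    apply/subspace_continuousP => s /=; rewrite in_itv /= => sT.
    apply: cvgD.
      by apply: cvg_mx_entry; apply: is_deriv_on_continuous; exact: dx.
    by apply: cvg_within_filter; apply: (@mulrl_continuous R e).
  by exists c; move: cT; rewrite in_itv.
pose j := [arg min_(j < i) y j (c j)]%O.
have jmin k s : 0 <= s <= T -> y j (c j) <= y k s.
  move=> sT; apply: le_trans ((cP k).2 _ sT).
  by rewrite /j; case: arg_minP => // l _; exact.
have [cT _] := cP j; set s := c j in jmin cT.
rewrite leNgt; apply/negP => yneg.
have ys : y j s < 0 by apply: le_lt_trans yneg; exact: jmin.
have s0 : 0 < s.
  rewrite lt_neqAle; have /andP[-> _] := cT; rewrite andbT.
  by apply: contraTneq ys => <-; rewrite /y mulr0 addr0 -leNgt.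
have dpos : 0 <= (Amx G *m x s) j 0.
  rewrite AmxE; apply: sumr_ge0 => k /weight_gt0/ltW wk; apply: mulr_ge0 => //.
  by rewrite subr_ge0; have := jmin k s cT; rewrite /y lerD2r.
have /is_deriv_onP/(_ e e0)[d d0 dP] := dx _ cT.
(* A small step back in time: the tilted minimum makes the difference
   quotient of the entry at most - e, while its limit is nonnegative. *)
pose h := - Num.min (d / 2) s.
have m0 : 0 < Num.min (d / 2) s by rewrite lt_min s0 divr_gt0.
have h0 : h < 0 by rewrite oppr_lt0.
have hd : `|h| < d.
  by rewrite normrN gtr0_norm // gt_min ltr_pdivrMr // ltr_pMr // ltr1n.
have hT : 0 <= s + h <= T.
  rewrite subr_ge0 ge_min lexx orbT /=; have /andP[_] := cT.
  by apply: le_trans; rewrite gerDl ltW.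
have := le_lt_trans (mx_entry_le_norm _ j 0) (dP _ (ltr0_neq0 h0) hd hT).
rewrite ltNge => /negP; apply.
move: (Amx G *m x s) dpos => v dpos; rewrite !mxE.
have := jmin j _ hT; rewrite /y.
set a := x (s + h) j 0; set b := x s j 0.
move=> ab; have {ab} : h^-1 * (a - b) <= - e.
  rewrite mulrC ler_ndivrMr //; nra.
by move=> q; rewrite ler_normr; apply/orP; right; lra.
Qed.

(** The difference of two solutions solves the linear equation and starts from
    zero, hence both it and its opposite are nonnegative. *)
Lemma ivp_solution_unique (R : realType) n (G : weighted_graph R n) T mu
    (sigma1 sigma2 : R -> 'cV[R]_n) :
  ivp_solution G T mu sigma1 -> ivp_solution G T mu sigma2 ->
  forall t, 0 <= t <= T -> sigma1 t = sigma2 t.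
Proof.
have le (s1 s2 : R -> 'cV[R]_n) : ivp_solution G T mu s1 ->
    ivp_solution G T mu s2 -> forall t, 0 <= t <= T -> forall i, s1 t i 0 <= s2 t i 0.
  move=> [_ d1 s10] [_ d2 s20] t tT i.
  have := @heat_min_principle R n G T (fun s => s2 s - s1 s) _ _ t tT i.
  rewrite !mxE subr_ge0; apply=> [s sT|j]; last by rewrite s10 s20 subrr mxE.
  rewrite /is_deriv_on mulmxBr -!(div_grad_logE G).
  apply: cvg_trans (cvgB (d2 s sT) (d1 s sT)).
  apply: near_eq_cvg; near=> h => /=.
  by rewrite -[LHS]scalerBr [in LHS]opprD addrACA -opprD.
move=> h1 h2 t tT; apply/colP => i; apply/eqP.
by rewrite eq_le !(le _ _ h1 h2, le _ _ h2 h1).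
Unshelve. all: by end_near. Qed.

Lemma heat_semigroup (R : realType) n (G : weighted_graph R n) (T : R) : 
  exists S : R -> 'M[R]_n,
    [/\ S 0 = 1%:M,
        forall t, Amx G *m S t = S t *m Amx G,
        forall t, 0 <= t <= T -> forall mu, prob mu -> prob (S t *m mu)
      & forall mu, prob mu -> ivp_solution G T mu (fun t => S t *m mu)].
Proof.
have [S [S0 SA Smass dS]] := symmetric_flow (Amx_sym G).
have Sprob t : 0 <= t <= T -> forall mu, prob mu -> prob (S t *m mu).
  move=> tT mu [m1 m0]; split.
    by rewrite sum_entriesE mulmxA Smass ?Amx_mass // -sum_entriesE.
  apply: (heat_min_principle (G := G) (T := T) (x := fun s => S s *m mu)) => //.
  by move=> i; rewrite S0 mul1mx.
exists S; split=> // mu pmu; split=> [t tT|t tT|]; first exact: Sprob.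
  by rewrite div_grad_logE; exact: dS.
by rewrite S0 mul1mx.
Qed.

(** * Frechet derivatives on the simplex *)

Lemma dotvE (R : realType) n (x y : 'cV[R]_n) : dotv x y = (x^T *m y) 0 0.
Proof. by rewrite mxE; apply: eq_bigr => i _; rewrite mxE. Qed.

Lemma dotvZr (R : realType) n (x y : 'cV[R]_n) (a : R) : dotv x (a *: y) = a * dotv x y.
Proof. by rewrite !dotvE -scalemxAr mxE. Qed.

Lemma dotvBr (R : realType) n (x y z : 'cV[R]_n) : dotv x (y - z) = dotv x y - dotv x z.
Proof. by rewrite !dotvE mulmxBr !mxE. Qed.

Lemma dotv_tr (R : realType) n (M : 'M[R]_n) (x y : 'cV[R]_n) :
  dotv (M^T *m x) y = dotv x (M *m y).
Proof. by rewrite !dotvE trmx_mul trmxK mulmxA. Qed.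

(** The directions towards the vertices of the simplex determine f up to an
    additive constant, which the normalization of the sum fixes. *)
Lemma is_frechet_unique (R : realType) n (F : 'cV[R]_n -> R) rho f g :
  prob rho -> is_frechet F rho f -> is_frechet F rho g -> f = g.
Proof.
move=> prho [f0 Ff] [g0 Fg].
have fg rho' : prob rho' -> dotv f (rho' - rho) = dotv g (rho' - rho).
  move=> prho'; have := Ff _ prho'; have := Fg _ prho'.
  set W := within _ _; have WF : ProperFilter W.
    split; last exact: within_filter.
    move=> /nbhs_ballP[d /= d0 dP].
    have m0 : 0 < Num.min (d / 2) 1 by rewrite lt_min ltr01 divr_gt0.
    apply: (dP (Num.min (d / 2) 1)) => /=.
    - rewrite /ball /= sub0r normrN gtr0_norm // gt_min.
      by rewrite ltr_pdivrMr // ltr_pMr // ltr1n.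
    - by rewrite gt_eqF.
    - by apply: prob_conv => //; rewrite ltW //= ge_min lexx orbT.
  by move=> Wg Wf; apply: (cvg_unique _ Wf Wg).
pose c := dotv f rho - dotv g rho.
have fgc i : f i 0 - g i 0 = c.
  have := fg _ (prob_delta R i); rewrite !dotvBr.
  have dE (h : 'cV[R]_n) : dotv h (delta_mx i 0) = h i 0.
    rewrite /dotv (bigD1 i) //= mxE !eqxx mulr1 big1 ?addr0 // => j /negbTE ji.
    by rewrite mxE ji mulr0.
  by rewrite !dE /c; lra.
have c0 : c = 0.
  have : \sum_(i < n) c = 0.
    by under eq_bigr => i _ do rewrite -(fgc i); rewrite sumrB f0 g0 subr0.
  rewrite sumr_const card_ord => /eqP; rewrite mulrn_eq0 => /orP[/eqP n0|/eqP//].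
  have [+ _] := prho; rewrite big1 => [/eqP|i]; first by rewrite eq_sym oner_eq0.
  by have := ltn_ord i; rewrite [X in (_ < X)%N]n0.
by apply/colP => i; have := fgc i; rewrite c0; lra.
Qed.

Lemma frechetE (R : realType) n (F : 'cV[R]_n -> R) rho f :
  prob rho -> is_frechet F rho f -> frechet F rho = f.
Proof.
move=> prho Ff; apply: (is_frechet_unique prho _ Ff).
exact: (xgetPex 0 (ex_intro _ f Ff)).
Qed.

(** Reparametrization of the defining limit: the segment from rho to rho' is
    run at speed 1 / c, and c may be negative.  The difference quotient in a
    direction v is thus available at every point of a segment directed by v,
    at the far end as well, where rho' lies backwards. *)
Lemma is_frechet_dir (R : realType) n (F : 'cV[R]_n -> R) (rho rho' v f : 'cV[R]_n) (c : R) :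
  is_frechet F rho f -> prob rho' -> rho' - rho = c *: v -> c != 0 ->
  (fun h => h^-1 * (F (rho + h *: v) - F rho))
    @ within [set h | prob (rho + h *: v)] (0 : R)^' --> dotv f v.
Proof.
move=> [_ Ff] prho' rv c0; have := Ff _ prho'; rewrite rv dotvZr => Fc.
have -> : dotv f v = c^-1 * (c * dotv f v) by rewrite mulKf.
have seg h : rho + h *: v = (1 - h / c) *: rho + (h / c) *: rho'.
  have -> : rho' = rho + c *: v by rewrite -rv addrC subrK.
  by rewrite scalerDr scalerA divfK // addrA -scalerDl subrK scale1r.
have toc : (fun h => h / c) @ within [set h | prob (rho + h *: v)] (0 : R)^' -->
    within [set t : R | prob ((1 - t) *: rho + t *: rho')] (0 : R)^'.
  move=> P /nbhs_ballP[d /= d0 dP]; apply/nbhs_ballP.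
  exists (d * `|c|) => /=; first by rewrite mulr_gt0 ?normr_gt0.
  move=> h; rewrite /ball /= sub0r normrN => hd h0 ph; apply: dP => /=.
  - by rewrite /ball /= sub0r normrN normrM normfV ltr_pdivrMr ?normr_gt0.
  - by rewrite mulf_neq0 ?invr_neq0.
  - by rewrite -seg.
have {}Fc := cvg_comp _ _ toc Fc.
apply: cvg_trans (cvgM (cvg_cst c^-1) Fc); apply: near_eq_cvg; near=> h => /=.
have h0 : h != 0.
  near: h; apply: cvg_within.
  apply/nbhs_ballP; exists 1 => //= y _.
by rewrite seg; field; rewrite h0 c0.
Unshelve. all: by end_near. Qed.

(** At interior points and at the start the segment is directed towards y; at
    the end s = 1 this direction degenerates and x, backwards, replaces y. *)
Lemma frechet_segment_deriv (R : realType) n (F : 'cV[R]_n -> R) (x y : 'cV[R]_n) s :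
  frechet_C1 F -> prob x -> prob y -> 0 <= s <= 1 ->
  is_deriv_on 1 (fun r => F (x + r *: (y - x)) : R^o) s
    (dotv (frechet F (x + s *: (y - x))) (y - x)).
Proof.
move=> [Fd _] px py s01; set p := x + s *: (y - x).
have pp : prob p by exact: prob_segment.
have [c [z [c0 pz zE]]] : exists c z, [/\ c != 0, prob z & z - p = c *: (y - x)].
  have [s1|s1] := eqVneq s 1.
    exists (-1), x; split; rewrite ?oppr_eq0 ?oner_eq0 //.
    by rewrite /p s1 scale1r scaleN1r opprD addNKr.
  exists (1 - s), y; split; rewrite ?subr_eq0 1?eq_sym //.
  by rewrite /p opprD addrA scalerBl scale1r.
have := is_frechet_dir (Fd _ pp) pz zE c0; apply: cvg_trans.
have step h : x + (s + h) *: (y - x) = p + h *: (y - x).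
  by rewrite scalerDl addrA.
rewrite /is_deriv_on; under eq_fun do rewrite step.
apply: cvg_app; apply: within_subset => h /= sh.
by rewrite -step; exact: prob_segment.
Qed.

Lemma frechet_mean_value (R : realType) n (F : 'cV[R]_n -> R) (x y : 'cV[R]_n) :
  frechet_C1 F -> prob x -> prob y ->
  exists2 s, 0 <= s <= 1 &
    F y - F x = dotv (frechet F (x + s *: (y - x))) (y - x).
Proof.
move=> FC px py; set v := y - x.
have dF s := @frechet_segment_deriv R n F x y s FC px py.
have [s||s sI] := @MVT_segment R (fun r => F (x + r *: v))
    (fun r => dotv (frechet F (x + r *: v)) v) 0 1 ler01.
- rewrite in_itv /= => /andP[s0 s1]; apply: is_deriv_on_derive.
    by rewrite s0; exact: s1.
  by apply: dF; rewrite !ltW.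
- apply/subspace_continuousP => s /=; rewrite in_itv /= => s01.
  exact: is_deriv_on_continuous (dF _ s01).
- have -> : x + 1 *: v = y by rewrite scale1r addrC subrK.
  rewrite scale0r addr0 subr0 mulr1 => ->.
  by exists s; rewrite // in_itv in sI.
Qed.

(** The mean value theorem turns the increment of F along the chord from
    sigma t to sigma (t + h) into a pairing of that chord with the derivative at
    an intermediate point, which tends to sigma t inside the simplex;
    the continuity of the derivative concludes. *)
Lemma frechet_chain_rule (R : realType) n (F : 'cV[R]_n -> R) (T : R)
    (sigma : R -> 'cV[R]_n) t v :
  frechet_C1 F -> (forall s, 0 <= s <= T -> prob (sigma s)) -> 0 <= t <= T ->
  is_deriv_on T sigma t v ->
  is_deriv_on T (fun s => F (sigma s) : R^o) t (dotv (frechet F (sigma t)) v).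
Proof.
move=> FC ps tT dsigma.
(* The value 0 is a default for steps leaving the time interval. *)
have /boolp.choice[xi xiP] : forall h, exists s, 0 <= s <= 1 /\
    (0 <= t + h <= T -> F (sigma (t + h)) - F (sigma t) =
      dotv (frechet F (sigma t + s *: (sigma (t + h) - sigma t)))
        (sigma (t + h) - sigma t)).
  move=> h; case: (boolP (0 <= t + h <= T)) => [hT|_]; last first.
    by exists 0; rewrite lexx ler01.
  by have [s s01 E] := frechet_mean_value FC (ps _ tT) (ps _ hT); exists s.
pose p h := sigma t + xi h *: (sigma (t + h) - sigma t).
have cp : p @ within [set h | 0 <= t + h <= T] (0 : R)^' -->
    within prob (nbhs (sigma t)).
  move=> P /nbhs_ballP[e /= e0 eP].
  have /cvgrPdist_lt/(_ e e0)/nbhs_ballP[d /= d0 dP] :=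
    is_deriv_on_continuous dsigma.
  apply/nbhs_ballP; exists d => //= h; rewrite /ball /= sub0r normrN => hd _ hT.
  have [xi01 _] := xiP h; apply: eP; last exact: prob_segment (ps _ tT) (ps _ hT) _.
  rewrite -ball_normE /= /p opprD addNKr normrN normrZ.
  apply: le_lt_trans (dP (t + h) _ _); last 2 first.
  - by rewrite /ball /= opprD addNKr normrN.
  - by rewrite /= in_itv.
  by rewrite [leRHS]distrC ger0_norm ?ler_piMl //; case/andP: xi01.
have /subspace_continuousP/(_ _ (ps _ tT)) cF := FC.2.
have cFp := cvg_comp _ _ cp cF.
rewrite /is_deriv_on; apply: cvg_trans (cvg_dotv cFp dsigma).
apply: near_eq_cvg; rewrite near_withinE; near=> h => hT /=.
by rewrite dotvZr -(xiP h).2.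
Unshelve. all: by end_near. Qed.

(** Orthogonal projection onto the vectors of sum zero, where Frechet
    derivatives are normalized to lie. *)
Definition sub_mean (R : realType) n (v : 'cV[R]_n) : 'cV[R]_n :=
  v - const_mx ((\sum_i v i 0) / n%:R).

Lemma sum_sub_mean (R : realType) n (v : 'cV[R]_n) : (0 < n)%N -> \sum_i sub_mean v i 0 = 0.
Proof.
move=> n0; under eq_bigr do rewrite !mxE.
rewrite sumrB sumr_const card_ord -[_ *+ n]mulr_natr divfK ?subrr //.
by rewrite pnatr_eq0 -lt0n.
Qed.

Lemma dotv_sub_mean (R : realType) n (v w : 'cV[R]_n) :
  \sum_i w i 0 = 0 -> dotv (sub_mean v) w = dotv v w.
Proof.
move=> w0; rewrite /dotv /sub_mean; under eq_bigr do rewrite !mxE mulrBl.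
by rewrite sumrB -mulr_sumr w0 mulr0 subr0.
Qed.

Lemma cvg_sub_mean (R : realType) n (I : Type) (H : set_system I) {FH : Filter H}
    (f : I -> 'cV[R]_n) (a : 'cV[R]_n) :
  f @ H --> a -> (fun x => sub_mean (f x)) @ H --> sub_mean a.
Proof.
move=> fa; apply: cvg_mx_entries => i j; rewrite /sub_mean !mxE.
under eq_fun do rewrite !mxE.
apply: cvgB; first exact: cvg_mx_entry.
apply: cvgM; last exact: cvg_cst.
by apply: cvg_big => [|k _]; [exact: add_continuous|exact: cvg_mx_entry].
Qed.

(** A linear map preserving the simplex sends segments to segments with the same
    parameter, so the defining limits for F o M are among those for F. *)
Lemma frechet_precomp (R : realType) n (M : 'M[R]_n) (F F' : 'cV[R]_n -> R) :
  (forall rho, prob rho -> prob (M *m rho)) ->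
  (forall rho, prob rho -> F' rho = F (M *m rho)) ->
  frechet_C1 F ->
  frechet_C1 F' /\ forall rho, prob rho ->
    frechet F' rho = sub_mean (M^T *m frechet F (M *m rho)).
Proof.
move=> Mp F'E [Fd Fc].
pose g rho := sub_mean (M^T *m frechet F (M *m rho)).
have gP rho : prob rho -> is_frechet F' rho (g rho).
  move=> pr; split; first exact/sum_sub_mean/(prob_pos pr).
  move=> rho' pr'; rewrite dotv_sub_mean ?dotv_tr ?mulmxBr; last first.
    under eq_bigr do rewrite !mxE.
    by rewrite sumrB; case: pr => -> _; case: pr' => -> _; rewrite subrr.
  have := (Fd _ (Mp _ pr)).2 _ (Mp _ pr').
  have Mseg t : M *m ((1 - t) *: rho + t *: rho') =
      (1 - t) *: (M *m rho) + t *: (M *m rho').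
    by rewrite mulmxDr -!scalemxAr.
  move=> FMc.
  have {}FMc : (fun t => (F (M *m ((1 - t) *: rho + t *: rho')) - F (M *m rho)) / t)
      @ within [set t | prob ((1 - t) *: rho + t *: rho')] (0 : R)^' -->
      dotv (frechet F (M *m rho)) (M *m rho' - M *m rho).
    under eq_fun do rewrite Mseg.
    apply: cvg_trans FMc; apply: cvg_app; apply: within_subset => t /= pt.
    by rewrite -Mseg; exact: Mp.
  apply: cvg_trans FMc; apply: near_eq_cvg; rewrite near_withinE; near=> t => pt.
  by rewrite /= !F'E.
have gE rho : prob rho -> frechet F' rho = g rho.
  by move=> pr; exact: frechetE pr (gP _ pr).
split=> //; split=> [rho pr|]; first by rewrite gE //; exact: gP.
have cg : {within prob, continuous g}.
  apply/subspace_continuousP => rho pr.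
  apply: cvg_sub_mean.
  apply: cvg_mulmx.
  have /subspace_continuousP/(_ _ (Mp _ pr)) FcM := Fc.
  apply: (cvg_comp (mulmx M) (frechet F) _ FcM) => P /= MP.
  have Mc : (fun x : 'cV[R]_n => M *m x) @ nbhs rho --> M *m rho.
    by apply: cvg_mulmx; exact: cvg_id.
  apply: (@filterS _ (nbhs rho) _ _ _ _ (Mc _ MP)) => x MPx px.
  by apply: MPx; exact: Mp.
by apply: subspace_eq_continuous cg => rho; rewrite inE => pr; exact/esym/gE.
Unshelve. all: by end_near. Qed.

(** * Existence, uniqueness and the evolution equation *)

Theorem theorem3p5 (R : realType) (n : nat) (G : weighted_graph R n)
    (u0 : 'cV[R]_n -> R) (hu0 : frechet_C1 u0) (T : R) (hT : 0 < T) :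
  (forall mu : 'cV[R]_n, prob mu ->
    exists sigma : R -> 'cV[R]_n,
      [/\ ivp_solution G T mu sigma,
          forall t : R, 0 <= t <= T ->
            div_grad_log G (sigma t) = Amx G *m sigma t
        & forall sigma' : R -> 'cV[R]_n, ivp_solution G T mu sigma' ->
            forall t : R, 0 <= t <= T -> sigma' t = sigma t]) /\
  (forall sigma : 'cV[R]_n -> R -> 'cV[R]_n,
    (forall mu, prob mu -> ivp_solution G T mu (sigma mu)) ->
    let u := fun (t : R) (mu : 'cV[R]_n) => u0 (sigma mu t) in
    [/\ forall t : R, 0 <= t <= T -> frechet_C1 (u t),
        forall (t : R) (mu : 'cV[R]_n), 0 <= t <= T -> prob mu ->
          is_deriv_on T (fun s => u s mu : R^o) t (Delta_ind G u t mu)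
      & forall mu, prob mu -> u 0 mu = u0 mu]).
Proof.
have [S [S0 SA Sprob Ssol]] := heat_semigroup G T.
split=> [mu pmu|sigma sol u].
  exists (fun t => S t *m mu); split; first exact: Ssol.
    by move=> t _; exact: div_grad_logE.
  by move=> sigma' sol'; exact: ivp_solution_unique sol' (Ssol _ pmu).
have uE t : 0 <= t <= T -> forall mu, prob mu -> u t mu = u0 (S t *m mu).
  by move=> tT mu pmu; rewrite /u (ivp_solution_unique (sol _ pmu) (Ssol _ pmu) tT).
have fu t tT := frechet_precomp (Sprob t tT) (uE t tT) hu0.
split=> [t tT|t mu tT pmu|mu pmu]; first exact: (fu t tT).1.
  have [sprob dsigma _] := sol _ pmu.
  have := frechet_chain_rule hu0 sprob tT (dsigma _ tT).
  rewrite div_grad_logE Delta_indE (fu t tT).2 // dotv_sub_mean; last first.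
    by rewrite sum_entriesE mulmxA Amx_mass mul0mx mxE.
  by rewrite dotv_tr mulmxA -SA -mulmxA (ivp_solution_unique (sol _ pmu) (Ssol _ pmu) tT).
by rewrite /u; have [_ _ ->] := sol _ pmu.
Qed.
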